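(* Let $\Omega$ be a set. If $\Omega$ is infinite, then $\sim_s$ is the universal relation on $\mathcal{T}(\Omega)$, $\mathcal{PT}(\Omega)$, and $\mathcal{I}(\Omega)$. If $\Omega$ is finite, then in each of these semigroups there are three $\sim_s$-congruence classes, consisting of the even permutations of $\Omega$, the odd permutations of $\Omega$, and the (partial) transformations (elements of the semigroup) with image of size $<|\Omega|$.
   Context: $\mathcal{T}(\Omega)$ is the monoid of all functions from $\Omega$ to $\Omega$; $\mathcal{PT}(\Omega)$ is the monoid of all partial functions from $\Omega$ to $\Omega$ (functions between subsets of $\Omega$, where $st$ is the composite of $s$ and $t$, with $t$ applied first, restricted to the domain $t^{-1}(\mathrm{Dom}(s)\cap\mathrm{Im}(t))$); $\mathcal{I}(\Omega)$ is the symmetric inverse monoid on $\Omega$, consisting of the bijections between subsets of $\Omega$, with the same composition. For a monoid $S$ and $s,t\in S$, $s\sim_s^1 t$ means that there exist a positive integer $n$, elements $p_1,\dots,p_n\in S$, and a permutation $f$ of $\{1,\dots,n\}$ such that $s=p_1\cdots p_n$ and $t=p_{f(1)}\cdots p_{f(n)}$; $\sim_s$ is the transitive closure of $\sim_s^1$, and it is a congruence on $S$. The universal relation on $S$ is $S\times S$.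
   Formalization: For finite Ω with at most one element there are no odd permutations, so ''three classes'' fails; the formal theorem says the classes are the nonempty ones among the three listed sets for every finite Ω, and that there are exactly three when |Ω| ≥ 2. *)

(* Defs.v *)
From HB Require Import structures.
From Stdlib Require Import Relation_Operators.
From mathcomp Require Import all_boot all_fingroup.
From mathcomp Require Import boolp classical_sets functions cardinality.

Set Implicit Arguments.
Unset Strict Implicit.
Unset Printing Implicit Defensive.

Local Open Scope classical_set_scope.

Definition transf (Omega : Type) := Omega -> Omega.

(* [f x = None] means that [x] is outside the domain of [f]. *)
Definition ptransf (Omega : Type) := Omega -> option Omega.

(* A partial function is a bijection between two subsets (its domain and its
   image) iff it is injective on its domain. *)
Definition partial_inj (Omega : Type) (f : ptransf Omega) :=
  forall x y z, f x = Some z -> f y = Some z -> x = y.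

Definition syminv (Omega : Type) := {f : ptransf Omega | partial_inj f}.

Section Monoids.
Variable Omega : Type.

(* In all three products the right factor is applied first. *)

Definition transf_mul (s t : transf Omega) : transf Omega := fun x => s (t x).
Definition transf_one : transf Omega := fun x => x.

Fact transf_mulA : associative transf_mul. Proof. by []. Qed.
Fact transf_mul1g : left_id transf_one transf_mul. Proof. by []. Qed.
Fact transf_mulg1 : right_id transf_one transf_mul. Proof. by []. Qed.

HB.instance Definition _ := gen_eqMixin (transf Omega).
HB.instance Definition _ := gen_choiceMixin (transf Omega).
HB.instance Definition _ :=
  isMonoid.Build (transf Omega) transf_mulA transf_mul1g transf_mulg1.

Definition ptransf_mul (s t : ptransf Omega) : ptransf Omega :=
  fun x => obind s (t x).
Definition ptransf_one : ptransf Omega := fun x => Some x.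

Fact ptransf_mulA : associative ptransf_mul.
Proof. by move=> s t u; apply/funext => x; rewrite /ptransf_mul; case: (u x). Qed.
Fact ptransf_mul1g : left_id ptransf_one ptransf_mul.
Proof. by move=> s; apply/funext => x; rewrite /ptransf_mul; case: (s x). Qed.
Fact ptransf_mulg1 : right_id ptransf_one ptransf_mul. Proof. by []. Qed.

HB.instance Definition _ := gen_eqMixin (ptransf Omega).
HB.instance Definition _ := gen_choiceMixin (ptransf Omega).
HB.instance Definition _ :=
  isMonoid.Build (ptransf Omega) ptransf_mulA ptransf_mul1g ptransf_mulg1.

Fact partial_inj_mul (s t : ptransf Omega) :
  partial_inj s -> partial_inj t -> partial_inj (ptransf_mul s t).
Proof.
move=> sI tI x y z; rewrite /ptransf_mul.
case tx: (t x) => [a|//] /= sa; case ty: (t y) => [b|//] /= sb.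
by apply: (tI _ _ a) => //; rewrite ty (sI _ _ _ sa sb).
Qed.
Fact partial_inj_one : partial_inj ptransf_one.
Proof. by move=> x y z [->] [->]. Qed.

Definition syminv_mul (s t : syminv Omega) : syminv Omega :=
  exist _ (ptransf_mul (sval s) (sval t)) (partial_inj_mul (svalP s) (svalP t)).
Definition syminv_one : syminv Omega := exist _ ptransf_one partial_inj_one.

Fact syminv_inj (s t : syminv Omega) : sval s = sval t -> s = t.
Proof. by move: s t => [s ps] [t pt] /= st; exact: eq_exist. Qed.
Fact syminv_mulA : associative syminv_mul.
Proof. by move=> s t u; apply/syminv_inj/ptransf_mulA. Qed.
Fact syminv_mul1g : left_id syminv_one syminv_mul.
Proof. by move=> s; apply/syminv_inj/ptransf_mul1g. Qed.
Fact syminv_mulg1 : right_id syminv_one syminv_mul.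
Proof. by move=> s; apply/syminv_inj/ptransf_mulg1. Qed.

HB.instance Definition _ := gen_eqMixin (syminv Omega).
HB.instance Definition _ := gen_choiceMixin (syminv Omega).
HB.instance Definition _ :=
  isMonoid.Build (syminv Omega) syminv_mulA syminv_mul1g syminv_mulg1.

End Monoids.

Section Similarity.
Variable S : monoidType.

Definition sim1 (s t : S) : Prop :=
  exists (n : nat) (p : 'I_n -> S) (f : {perm 'I_n}),
    [/\ (0 < n)%N, s = (\prod_(i < n) p i)%g & t = (\prod_(i < n) p (f i))%g].

Definition sim : S -> S -> Prop := clos_trans S sim1.

Definition sim_universal : Prop := forall s t : S, sim s t.

Definition sim_classes : set (set S) := range (fun s : S => [set t | sim s t]).

End Similarity.
Arguments sim_universal S : clear implicits.
Arguments sim_classes S : clear implicits.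

(* [act] sends an element of one of the three monoids to the partial function
   on [Omega] that it is. *)
Section FiniteClasses.
Variables (Omega : finType) (S : Type) (act : S -> ptransf Omega).

Definition even_perms : set S :=
  [set s | exists2 g : {perm Omega}, ~~ odd_perm g & act s = Some \o g].

Definition odd_perms : set S :=
  [set s | exists2 g : {perm Omega}, odd_perm g & act s = Some \o g].

Definition small_image : set S :=
  [set s | (#|[pred y | [exists x, act s x == Some y]]| < #|Omega|)%N].

End FiniteClasses.

Definition act_transf (Omega : Type) (s : transf Omega) : ptransf Omega :=
  Some \o s.
Definition act_ptransf (Omega : Type) (s : ptransf Omega) : ptransf Omega := s.
Definition act_syminv (Omega : Type) (s : syminv Omega) : ptransf Omega :=
  sval s.

Definition parity_image_classes (Omega : finType) (S : Type)
    (act : S -> ptransf Omega) : set (set S) :=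
  [set even_perms act; odd_perms act; small_image act].

(* Main.v *)
Require Import Defs.
From Stdlib Require Import Relation_Operators.
From mathcomp Require Import all_boot all_fingroup.
From mathcomp Require Import boolp classical_sets functions cardinality.

Set Implicit Arguments.
Unset Strict Implicit.
Unset Printing Implicit Defensive.

Local Open Scope classical_set_scope.

(** In the quotient of a monoid by [sim] the order of the factors of a product
    is forgotten: [sim] is a congruence and [s * t] is similar to [t * s], so
    conjugate elements are similar ([sim_conj]).

    If [Omega] is infinite, it contains two disjoint copies of itself: there
    are injections [p], [q] from [Omega] to itself with disjoint images
    ([infinite_double], from Zorn's lemma).  They have left inverses [p'], [q']
    for which [p' q] is a left zero [z]: the empty map, or a constant in the
    full transformation monoid.  The element [s = (p' p) (q' q) s] is then
    similar to [(p p') (q q') s = p (p' q) q' s = p z], which does not involve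
    [s] ([sim_universal_of_zero]).

    If [Omega] is finite, each element either acts as a permutation or misses a
    point ([parity_or_small]).
    - A product acts as a permutation iff all its factors do, and its parity is
      then the sum of their parities, which does not depend on their order; so
      [sim] preserves acting as a permutation of given parity ([sim_parity]).
    - All transpositions are conjugate, hence similar, so a permutation is
      similar to the power of one transposition given by its parity
      ([sim_perm_elt]).
    - An element [s] missing the point [y] equals [e s], where [e] is the
      idempotent that removes [y] from the domain or, for full transformations,
      moves [y] onto another point [z].  These idempotents are conjugate to one
      another, and some product of them is a left zero: the empty map or a
      constant.  An idempotent is similar to any nonempty product of elements
      similar to it, so [e] is similar to a left zero [w], and [s = e s] is
      similar to [w s = w].  There is only one empty map, and any two constants
      [a], [b] are the products [a b = a] and [b a = b]. *)

(** * Similarity in an arbitrary monoid *)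

Section SimilarityTheory.
Variable S : monoidType.
Implicit Types (s t u m w : S) (l : seq S).
Local Open Scope group_scope.

(** Factor lists up to [perm_eq] are easier to extend by a factor or to
    concatenate than families indexed by ordinals. *)
Lemma sim1_perm_eq s t : sim1 s t ->
  exists l l', [/\ perm_eq l l', s = \prod_(x <- l) x & t = \prod_(x <- l') x].
Proof.
case=> n [p [f [_ -> ->]]].
exists (map p (index_enum 'I_n)), (map p (map f (index_enum 'I_n))).
rewrite !big_map; split=> //; apply/perm_map/uniq_perm.
- exact: index_enum_uniq.
- by rewrite map_inj_uniq ?index_enum_uniq //; exact: perm_inj.
move=> i; rewrite mem_index_enum; apply/esym/mapP.
by exists (f^-1 i); rewrite ?mem_index_enum // permKV.
Qed.

Lemma perm_eq_sim1 l l' : perm_eq l l' ->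
  sim1 (\prod_(x <- l) x) (\prod_(x <- l') x).
Proof.
(* The factor 1 put in front makes the number of factors positive. *)
move=> ll'; have /tuple_permP[f l'E] : perm_eq (1 :: l') (in_tuple (1 :: l)).
  by rewrite perm_cons perm_sym.
exists (size (1 :: l)), (tnth (in_tuple (1 :: l))), f; split=> //.
  by rewrite -(big_tnth _ _ _ xpredT id) big_cons mul1g.
rewrite -[LHS]mul1g -(big_cons _ _ 1 l' xpredT id) l'E.
by rewrite big_tuple; apply: eq_bigr => i _; rewrite tnth_mktuple.
Qed.

Lemma sim_prod l l' : perm_eq l l' ->
  sim (\prod_(x <- l) x) (\prod_(x <- l') x).
Proof. by move=> /perm_eq_sim1; exact: t_step. Qed.

Lemma sim_refl s : sim s s.
Proof. by have := @sim_prod [:: s] [:: s] (perm_refl _); rewrite !big_seq1. Qed.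

Lemma sim_trans t s u : sim s t -> sim t u -> sim s u.
Proof. exact: t_trans. Qed.

Lemma sim_sym s t : sim s t -> sim t s.
Proof.
elim=> {s t} [s t|s t u _ ts _ ut]; last exact: sim_trans ut ts.
by move=> /sim1_perm_eq[l [l' [ll' -> ->]]]; apply: sim_prod; rewrite perm_sym.
Qed.

Lemma simMC s t : sim (s * t) (t * s).
Proof.
have := @sim_prod [:: s; t] [:: t; s]; rewrite !big_cons !big_nil !mulg1; apply.
exact: permEl (perm_catC [:: s] [:: t]).
Qed.

Lemma simMl u s t : sim s t -> sim (u * s) (u * t).
Proof.
elim=> {s t} [s t|s t v _ st _ tv]; last exact: sim_trans st tv.
move=> /sim1_perm_eq[l [l' [ll' -> ->]]].
by rewrite -!(big_cons _ _ u _ xpredT id); apply: sim_prod; rewrite perm_cons.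
Qed.

Lemma simMr u s t : sim s t -> sim (s * u) (t * u).
Proof.
by move=> st; apply: sim_trans (simMC _ _) (sim_trans (simMl u st) (simMC _ _)).
Qed.

Lemma simM s t s' t' : sim s t -> sim s' t' -> sim (s * s') (t * t').
Proof. by move=> st st'; exact: sim_trans (simMr _ st) (simMl _ st'). Qed.

Lemma sim_conj u v m : v * u = 1 -> sim (u * m * v) m.
Proof.
move=> vu; apply: sim_trans (simMC _ _) _.
by rewrite mulgA vu mul1g; exact: sim_refl.
Qed.

(** In the quotient by [sim] all these factors become the same idempotent. *)
Lemma sim_prod_idem m l : m * m = m -> l != [::] -> {in l, forall x, sim x m} ->
  sim (\prod_(x <- l) x) m.
Proof.
move=> mm; elim: l => [//|x [|y l] IH] _ lm; rewrite big_cons.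
  by rewrite big_nil mulg1; apply: lm; rewrite inE.
rewrite -[X in sim _ X]mm; apply: simM; first by apply: lm; rewrite inE eqxx.
by apply: IH => // z zl; apply: lm; rewrite inE zl orbT.
Qed.

(** Swapping the factors of [p' * p] and of [q' * q] in
    [s = (p' * p) * (q' * q) * s] creates the left zero [p' * q], which absorbs
    [s]. *)
Lemma sim_universal_of_zero p p' q q' z : p' * p = 1 -> q' * q = 1 ->
  p' * q = z -> (forall s, z * s = z) -> sim_universal S.
Proof.
move=> pp qq pq z0.
suff sim_pz s : sim s (p * z).
  by move=> s t; apply: sim_trans (sim_pz s) (sim_sym (sim_pz t)).
have := simMr s (simM (simMC p' p) (simMC q' q)).
rewrite pp qq !mul1g; congr (sim _ _).
by rewrite -!mulgA [p' * _]mulgA pq z0.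
Qed.

Lemma sim_left_zero e w s :
  e * s = s -> (forall t, w * t = w) -> sim e w -> sim s w.
Proof. by move=> es w0 /(simMr s); rewrite es w0. Qed.

End SimilarityTheory.

(** * Doubling an infinite set *)

(** The classes come from a maximal family of disjoint countably infinite sets.
    By maximality only finitely many points are left over; adding them to one
    member of the family turns it into a partition.  The partition is encoded by
    the function [h] sending a point to its class. *)
Lemma countable_classes (T : Type) : infinite_set [set: T] ->
  exists h : T -> set T, [/\ forall x, h x x,
    forall x y, h x y -> h y = h x & forall x, (h x #= [set: nat])%card].
Proof.
move=> Tinf.
pose D := [set A : set T | (A #= [set: nat])%card].
have [E [ED Etriv Emax]] := ex_maximal_disjoint_subcollection id D.
pose C := ~` \bigcup_(A in E) A.
have Cfin : finite_set C.
  apply: contrapT => /infiniteP/card_subP[R Rnat RC].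
  (* [R] is disjoint from every member of the family, so adding it
     contradicts maximality. *)
  have EN A x : E A -> A x -> R x -> False.
    by move=> EA Ax /RC; apply; exists A.
  have [x0 Rx0] : R !=set0.
    apply: infinite_setN0; rewrite (eq_finite_set Rnat); exact: infinite_nat.
  apply: (Emax (E `|` [set R])).
  - split; first by move=> A; left.
    by move=> /(_ R (or_intror erefl)) ER; exact: (EN _ _ ER Rx0 Rx0).
  - by move=> A [/ED//|->].
  - move=> A B [EA|->] [EB|->] //= [x []].
    + by move=> Ax Bx; apply: Etriv => //; exists x.
    + by move=> Ax Rx; case: (EN A x).
    + by move=> Rx Bx; case: (EN B x).
have [A0 EA0] : exists A0, E A0.
  apply: contrapT => nE; apply: Tinf; suff <- : C = [set: T] by [].
  by apply/seteqP; split=> // x _ [A EA]; case: nE; exists A.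
(* The leftover points [C] join the block [A0]. *)
pose g A := A `|` [set x | A = A0 /\ C x].
have gC A x : E A -> A x -> C x -> False by move=> EA Ax; apply; exists A.
have gtriv A B x : E A -> E B -> g A x -> g B x -> A = B.
  move=> EA EB [Ax|[-> Cx]] [Bx|[-> Cx']] //; last 2 first.
  - by case: (gC A x).
  - by case: (gC B x).
  - by apply: Etriv => //; exists x.
have gcard A : E A -> (g A #= [set: nat])%card.
  move=> EA; have := ED _ EA; rewrite /D /= card_eq_le => /andP[Acnt natA].
  apply: eq_card_nat.
    rewrite /g -bigcup2E; apply: bigcup_countable => // -[|[|i]] _ //=.
      by apply/finite_set_countable/(sub_finite_set _ Cfin) => x [].
  by apply: (@sub_infinite_set _ A); [exact: subsetUl | exact/infiniteP].
have gcover x : exists A, E A /\ g A x.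
  have [[A EA Ax]|nx] := pselect ((\bigcup_(A in E) A) x).
    by exists A; split=> //; left.
  by exists A0; split=> //; right.
have [r rP] := choice gcover.
exists (g \o r); split => [x|x y gxy|x] /=; first by case: (rP x).
- by congr g; case: (rP x) (rP y) => Ex _ [Ey gy]; exact: gtriv gxy.
- by apply: gcard; case: (rP x).
Qed.

(** On each countable class, numbered by the naturals, the two maps are
    [n |-> 2n] and [n |-> 2n + 1]. *)
Lemma infinite_double (T : Type) : infinite_set [set: T] ->
  exists d : bool -> T -> T, forall b c x y, d b x = d c y -> b = c /\ x = y.
Proof.
move=> /countable_classes[h [hx hE hnat]].
have bijT (A : set T) : exists f : T -> nat,
    (A #= [set: nat])%card -> set_bij A setT f.
  have [/card_set_bijP[f fA]|nA] := pselect (A #= [set: nat])%card.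
    by exists f.
  by exists (fun=> 0).
have [f fP] := choice bijT.
have surjT (u : T * nat) : exists y, h u.1 y /\ f (h u.1) y = u.2.
  by have [_ _ /(_ u.2 Logic.I) [y hy fy]] := fP _ (hnat u.1); exists y.
have [g gP] := choice surjT.
pose d b x := g (x, b + (f (h x) x).*2).
have hd b x : h (d b x) = h x by apply: hE; case: (gP (x, b + (f (h x) x).*2)).
have fd b x : f (h x) (d b x) = b + (f (h x) x).*2.
  by case: (gP (x, b + (f (h x) x).*2)).
exists d => b c x y dxy.
have hxy : h x = h y by rewrite -(hd b) dxy hd.
have := fd b x; rewrite dxy hxy fd => fxy.
have cb : c = b.
  by move/(congr1 odd): fxy; rewrite !oddD !odd_double !addbF !oddb.
split=> //; move: fxy; rewrite cb => /addnI/double_inj fxy.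
have [_ /(_ y x) inj _] := fP _ (hnat y).
by apply/esym/inj => //; rewrite inE // -hxy.
Qed.

(** * Infinite sets *)

Lemma transf_mulE (T : Type) (s t : transf T) x : (s * t)%g x = s (t x).
Proof. by []. Qed.

Lemma ptransf_mulE (T : Type) (s t : ptransf T) x : (s * t)%g x = obind s (t x).
Proof. by []. Qed.

Lemma syminv_mulE (T : Type) (s t : syminv T) x :
  sval (s * t)%g x = obind (sval s) (sval t x).
Proof. by []. Qed.

Section Infinite.
Variable T : Type.
Implicit Types f g : T -> T.

Definition partial_inverse f : ptransf T := fun y =>
  if pselect (exists x, f x = y) is left fy then Some (sval (cid fy)) else None.

Lemma partial_inverseK f x : injective f -> partial_inverse f (f x) = Some x.
Proof.
move=> fI; rewrite /partial_inverse; case: pselect => [fx|[]]; last by exists x.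
by case: (cid fx) => y /= /fI ->.
Qed.

Lemma partial_inverse_out f y :
  (forall x, f x <> y) -> partial_inverse f y = None.
Proof.
move=> fy; rewrite /partial_inverse; case: pselect => // h.
by exfalso; case: h => x /fy.
Qed.

Lemma partial_inverse_inj f : partial_inj (partial_inverse f).
Proof.
move=> y y' x; rewrite /partial_inverse.
case: pselect => // fy; case: pselect => // fy' [<-] [e].
by rewrite -(svalP (cid fy)) -e (svalP (cid fy')).
Qed.

Lemma partial_inj_total f : injective f -> partial_inj (Some \o f).
Proof. by move=> fI x y z /= [<-] [/fI]. Qed.

Lemma partial_inj_none : partial_inj (fun _ : T => None).
Proof. by []. Qed.

Hypothesis Tinf : infinite_set [set: T].

Theorem sim_universal_transf : sim_universal (transf T).
Proof.
have [d dP] := infinite_double Tinf.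
have [c _] := infinite_setN0 Tinf.
have dI b : injective (d b) by move=> x y /dP[].
(* A total left inverse has to send the points outside the image of [d b]
   somewhere; as they all go to the same point [c], the product
   [d' false * d true] is constant. *)
pose d' b : transf T := odflt c \o partial_inverse (d b).
have d'K b : (d' b * (d b : transf T) = 1)%g.
  by apply/funext => x; rewrite transf_mulE /d' /= partial_inverseK.
pose z : transf T := fun=> c.
apply: (sim_universal_of_zero (d'K false) (d'K true) (z := z)) => //.
apply/funext => x; rewrite transf_mulE /d' /=.
by rewrite partial_inverse_out // => y /dP[].
Qed.

Theorem sim_universal_ptransf : sim_universal (ptransf T).
Proof.
have [d dP] := infinite_double Tinf.
have dI b : injective (d b) by move=> x y /dP[].
pose p b : ptransf T := Some \o d b.
have pK b : (partial_inverse (d b) * p b = 1)%g.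
  by apply/funext => x; exact: partial_inverseK.
pose z : ptransf T := fun=> None.
apply: (sim_universal_of_zero (pK false) (pK true) (z := z)).
  by apply/funext => x; apply: partial_inverse_out => y /dP[].
by move=> s; apply/funext => x; rewrite ptransf_mulE; case: (s x).
Qed.

Theorem sim_universal_syminv : sim_universal (syminv T).
Proof.
have [d dP] := infinite_double Tinf.
have dI b : injective (d b) by move=> x y /dP[].
pose p b : syminv T := exist _ (Some \o d b) (partial_inj_total (dI b)).
pose p' b : syminv T := exist _ _ (@partial_inverse_inj (d b)).
have pK b : (p' b * p b = 1)%g.
  by apply/syminv_inj/funext => x; exact: partial_inverseK.
pose z : syminv T := exist _ _ partial_inj_none.
apply: (sim_universal_of_zero (pK false) (pK true) (z := z)).
  by apply/syminv_inj/funext => x; apply: partial_inverse_out => y /dP[].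
move=> s; apply/syminv_inj/funext => x.
by rewrite syminv_mulE; case: (sval s x).
Qed.

End Infinite.

(** * Permutations in monoids of partial transformations of a finite set *)

(** The first transposition brings [x] to [a] and [y] to some [z != a]; the
    second one fixes [a] and brings [z] to [b]. *)
Lemma perm2_transitive (T : finType) (x y a b : T) : x != y -> a != b ->
  exists g : {perm T}, g x = a /\ g y = b.
Proof.
move=> xy ab; pose z := tperm x a y; exists (tperm x a * tperm z b)%g.
rewrite !permM tpermL tpermL tpermD //; last by rewrite eq_sym.
by rewrite -(inj_eq (@perm_inj _ (tperm x a))) tpermK tpermR eq_sym.
Qed.

(** The three monoids are treated at once, as a monoid [S] acting faithfully on
    [Omega] by partial functions, among which are all permutations. *)
Section FiniteAction.
Variables (Omega : finType) (S : monoidType) (act : S -> ptransf Omega).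
Hypothesis act_inj : injective act.
Hypothesis actM : forall s t x, act (s * t)%g x = obind (act s) (act t x).
Hypothesis act1 : forall x, act 1%g x = Some x.
Hypothesis act_perm : forall g : {perm Omega}, exists s, act s = Some \o g.
Implicit Types (s t : S) (g h : {perm Omega}).

Definition acts_with_parity (b : bool) s :=
  exists2 g : {perm Omega}, odd_perm g = b & act s = Some \o g.

Lemma small_imageP s :
  small_image act s <-> exists y, forall x, act s x <> Some y.
Proof.
split=> [|[y sy]]; last first.
  apply/proper_card/properP; split; first exact/fintype.subsetP.
  by exists y => //; rewrite inE; apply/existsP => -[x /eqP/sy].
apply: contraPP => ns; apply/negP; rewrite -leqNgt.
apply: subset_leq_card; apply/fintype.subsetP => y _; rewrite inE.
apply/existsP; apply: contrapT => sy; apply: ns; exists y => x sx.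
by apply: sy; exists x; exact/eqP.
Qed.

(** If [s] misses no point, choosing a preimage of every point is an injection,
    hence a permutation, and [s] acts as its inverse. *)
Lemma parity_or_small s : (exists b, acts_with_parity b s) \/ small_image act s.
Proof.
have [|ns] := pselect (small_image act s); [by right|left].
have surj y : exists x, act s x = Some y.
  apply: contrapT => nx; apply/ns/small_imageP; exists y => x sx.
  by apply: nx; exists x.
have [k kP] := choice surj.
have kI : injective k by move=> y z kyz; have := kP y; rewrite kyz kP => -[].
exists (odd_perm (perm kI)^-1)%g; exists (perm kI)^-1%g => //.
by apply/funext => x; rewrite -{1}(permKV (perm kI) x) permE kP.
Qed.

Lemma parity_not_small b s : acts_with_parity b s -> ~ small_image act s.
Proof.
move=> [g _ sg] /small_imageP[y]; move/(_ (g^-1 y)%g); rewrite sg /=.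
by rewrite permKV.
Qed.

Lemma parity_uniq b c s : acts_with_parity b s -> acts_with_parity c s -> b = c.
Proof.
move=> [g <- sg] [h <- sh]; congr odd_perm; apply/permP => x.
by have := congr1 (@^~ x) sg; rewrite sh => -[].
Qed.

Lemma parity1 : acts_with_parity false 1%g.
Proof.
by exists 1%g; rewrite ?odd_perm1 //; apply/funext => x; rewrite act1 /= perm1.
Qed.

Lemma parityM b c s t : acts_with_parity b s -> acts_with_parity c t ->
  acts_with_parity (b (+) c) (s * t)%g.
Proof.
move=> [g <- sg] [h <- th]; exists (h * g)%g; first by rewrite odd_permM addbC.
by apply/funext => x; rewrite actM th /= sg /= permM.
Qed.

(** If [s * t] is surjective then so is [s]; on a finite set [s] is then a
    permutation, and [t] is the quotient of two permutations. *)
Lemma parityM_factors b s t : acts_with_parity b (s * t)%g ->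
  (exists c, acts_with_parity c s) /\ (exists c, acts_with_parity c t).
Proof.
move=> [g _ stg]; have stE x : obind (act s) (act t x) = Some (g x).
  by rewrite -actM stg.
have [sP|/small_imageP[y sy]] := parity_or_small s; last first.
  by have := stE (g^-1 y)%g; rewrite permKV; case: (act t _) => //= a /sy.
split=> //; case: sP => c [h _ sh].
exists (odd_perm (g * h^-1))%g; exists (g * h^-1)%g => //.
apply/funext => x; have := stE x; rewrite sh /= permM.
by case: (act t x) => //= a [<-]; rewrite permK.
Qed.

Lemma parity_prod_factors (l : seq S) b :
    acts_with_parity b (\prod_(x <- l) x)%g ->
  {in l, forall x, exists c, acts_with_parity c x}.
Proof.
elim: l b => [//|y l IH] b; rewrite big_cons => /parityM_factors[yP [c lP]] x.
by rewrite inE => /predU1P[->//|]; exact: IH lP _.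
Qed.

(** For [x] acting as a permutation, [`[< acts_with_parity true x >]] is its
    parity; this makes the parity of the product a commutative sum. *)
Lemma parity_prod (l : seq S) :
    {in l, forall x, exists c, acts_with_parity c x} ->
  acts_with_parity (\big[addb/false]_(x <- l) `[< acts_with_parity true x >])
    (\prod_(x <- l) x)%g.
Proof.
elim: l => [_|x l IH lP]; first by rewrite !big_nil; exact: parity1.
rewrite !big_cons; apply: parityM; last first.
  by apply: IH => y yl; apply: lP; rewrite inE yl orbT.
have [c xc] := lP x (mem_head _ _).
suff -> : `[< acts_with_parity true x >] = c by [].
by apply/asboolP/idP => [xt|cT]; [rewrite -(parity_uniq xt xc) | rewrite -cT].
Qed.

(** Permuting the factors does not change the sum of their parities. *)
Lemma sim_parity b s t :
  sim s t -> acts_with_parity b s -> acts_with_parity b t.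
Proof.
elim=> {s t} [s t|s u t _ su _ ut]; last by move=> /su/ut.
move=> /sim1_perm_eq[l [l' [ll' -> ->]]] lb.
have lP := parity_prod_factors lb.
rewrite (parity_uniq lb (parity_prod lP)) (perm_big _ ll') /=.
by apply: parity_prod => x; rewrite -(perm_mem ll'); exact: lP.
Qed.

Definition perm_elt g : S := sval (cid (act_perm g)).

Lemma act_perm_elt g : act (perm_elt g) = Some \o g.
Proof. exact: svalP (cid (act_perm g)). Qed.

(** The order is reversed because permutations compose from left to right and
    the elements of [S] from right to left. *)
Lemma perm_eltM g h : perm_elt (g * h) = (perm_elt h * perm_elt g)%g.
Proof.
by apply/act_inj/funext => x; rewrite actM !act_perm_elt /= permM.
Qed.

Lemma perm_elt1 : perm_elt 1 = 1%g.
Proof. by apply/act_inj/funext => x; rewrite act_perm_elt act1 /= perm1. Qed.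

Lemma perm_eltKV g : (perm_elt g^-1 * perm_elt g = 1)%g.
Proof. by rewrite -perm_eltM mulgV perm_elt1. Qed.

Lemma sim_tperm (x y a b : Omega) : x != y -> a != b ->
  sim (perm_elt (tperm x y)) (perm_elt (tperm a b)).
Proof.
move=> xy ab; have [g [<- <-]] := perm2_transitive xy ab.
rewrite -tpermJ conjgE !perm_eltM -mulgA; apply: sim_sym.
rewrite mulgA.
exact: sim_conj (perm_eltKV g).
Qed.

(** A permutation is a product of transpositions, all similar to
    [tperm a b], whose square is 1. *)
Lemma sim_perm_elt (a b : Omega) g : a != b ->
  sim (perm_elt g) (perm_elt (if odd_perm g then tperm a b else 1)%g).
Proof.
move=> ab; have [ts -> {g} ts_d] := prod_tpermP g.
elim: ts ts_d => [_|[x y] ts IH /= /andP[xy ts_d]].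
  by rewrite big_nil odd_perm1; exact: sim_refl.
rewrite big_cons odd_mul_tperm xy /= perm_eltM.
apply: sim_trans (simM (IH ts_d) (sim_tperm xy ab)) _.
rewrite -perm_eltM.
by case: odd_perm; rewrite /= ?mulg1 ?tperm2; exact: sim_refl.
Qed.

Lemma parity_sim b s t :
  acts_with_parity b s -> acts_with_parity b t -> sim s t.
Proof.
move=> [g gb sg] [h hb th].
have -> : s = perm_elt g by apply: act_inj; rewrite act_perm_elt.
have -> : t = perm_elt h by apply: act_inj; rewrite act_perm_elt.
have [[x [y xy]]|noxy] := pselect (exists x y : Omega, x != y).
  have := sim_perm_elt g xy; rewrite gb -hb => /sim_trans; apply.
  exact/sim_sym/sim_perm_elt.
(* Without two distinct points the only permutation is the identity. *)
suff -> : g = h by exact: sim_refl.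
apply/permP => x; apply: contrapT => /eqP gh.
by apply: noxy; exists (g x), (h x).
Qed.

Lemma even_permsE : even_perms act = [set s | acts_with_parity false s].
Proof.
by apply/seteqP; split=> s [g]; [move=> /negbTE gb sg|move=> gb sg];
  exists g => //; rewrite gb.
Qed.

Lemma sim_class_parity b s : acts_with_parity b s ->
  [set t | sim s t] = [set t | acts_with_parity b t].
Proof.
by move=> sb; apply/seteqP; split=> t /=; [move=> st; exact: sim_parity sb
  | exact: parity_sim].
Qed.

Section Classes.
Hypothesis small_sim : forall s t,
  small_image act s -> small_image act t -> sim s t.

Lemma sim_class_small s :
  small_image act s -> [set t | sim s t] = small_image act.
Proof.
move=> ss; apply/seteqP; split=> t /=; last exact: small_sim.
move=> /sim_sym ts; have [[b tb]|//] := parity_or_small t.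
by case: (parity_not_small (sim_parity ts tb)).
Qed.

Lemma sim_classes_parity_image :
  sim_classes S = parity_image_classes act `\ set0.
Proof.
apply/seteqP; split=> [_ [s _ <-]|X [XP /eqP/set0P[s Xs]]].
  split; last by move=> /(congr1 (@^~ s)) /= s0; rewrite -s0; exact: sim_refl.
  have [[[] sb]|ss] := parity_or_small s.
  - by left; right; rewrite (sim_class_parity sb).
  - by left; left; rewrite (sim_class_parity sb) even_permsE.
  - by right; rewrite (sim_class_small ss).
exists s => //; case: XP Xs => [[|]|] ->.
- by rewrite even_permsE; exact: sim_class_parity.
- exact: sim_class_parity.
- exact: sim_class_small.
Qed.

Lemma card_sim_classes : (1 < #|Omega|)%N -> small_image act !=set0 ->
  (sim_classes S #= `I_3)%card.
Proof.
move=> /card_gt1P[x [y [_ _ xy]]] [m ms].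
have odd_xy : acts_with_parity true (perm_elt (tperm x y)).
  by exists (tperm x y); rewrite ?odd_tperm ?act_perm_elt.
(* The default value [m] of [nth] represents the third class. *)
pose r n := nth m [:: 1%g; perm_elt (tperm x y)] n.
rewrite card_eq_sym; apply/card_set_bijP.
exists (fun n => [set t | sim (r n) t]).
split=> [n _|n k|_ [s _ <-]]; first by exists (r n).
  rewrite !inE /= => n3 k3 nk; have {nk} rnk : sim (r n) (r k).
    by have /= -> := congr1 (@^~ (r k)) nk; exact: sim_refl.
  have even_odd : ~ sim 1%g (perm_elt (tperm x y)).
    by move=> /sim_parity/(_ parity1)/(parity_uniq odd_xy).
  have parity_m b s : acts_with_parity b s -> ~ sim s m.
    by move=> sb sm; exact: parity_not_small (sim_parity sm sb) ms.
  case: n k n3 k3 rnk => [|[|[|n]]] [|[|[|k]]] //= _ _.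
  - by case/(parity_m _ _ parity1).
  - by move/sim_sym.
  - by case/(parity_m _ _ odd_xy).
  - by move/sim_sym/(parity_m _ _ parity1).
  - by move/sim_sym/(parity_m _ _ odd_xy).
have [[[] sb]|ss] := parity_or_small s.
- by exists 1%N => //; rewrite (sim_class_parity sb) (sim_class_parity odd_xy).
- by exists 0%N => //; rewrite (sim_class_parity sb) (sim_class_parity parity1).
- by exists 2 => //; rewrite (sim_class_small ss) (sim_class_small ms).
Qed.

End Classes.
End FiniteAction.

(** * Partial transformations missing a point *)

(** Partial functions and partial bijections both include the identity map [e y]
    of the complement of each point [y]. *)
Section Punctured.
Variables (Omega : finType) (S : monoidType) (act : S -> ptransf Omega).
Hypothesis act_inj : injective act.
Hypothesis actM : forall s t x, act (s * t)%g x = obind (act s) (act t x).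
Hypothesis act1 : forall x, act 1%g x = Some x.
Hypothesis act_perm : forall g : {perm Omega}, exists s, act s = Some \o g.
Variable e : Omega -> S.
Hypothesis actE : forall y x, act (e y) x = if x == y then None else Some x.

Lemma puncture_idem y : (e y * e y = e y)%g.
Proof.
apply/act_inj/funext => x; rewrite actM !actE.
by case: (boolP (x == y)) => //= /negbTE xy; rewrite actE xy.
Qed.

Lemma puncture_mul_id y s : (forall x, act s x <> Some y) -> (e y * s = s)%g.
Proof.
move=> sy; apply/act_inj/funext => x; rewrite actM.
case sx : (act s x) => [a|//] /=; rewrite actE.
by case: eqP => // ay; case: (sy x); rewrite sx ay.
Qed.

(** The transposition of [y] and [z] conjugates [e z] to [e y]. *)
Lemma sim_puncture y z : sim (e y) (e z).
Proof.
pose u := perm_elt act_perm (tperm y z).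
have := perm_eltKV act_inj actM act1 act_perm (tperm y z).
rewrite tpermV -/u => uu.
suff <- : (u * e z * u = e y)%g by exact: sim_conj.
apply/act_inj/funext => x; rewrite !actM act_perm_elt /= actM actE actE.
rewrite (canF_eq (tpermK y z)) tpermR.
by case: ifP => //= _; rewrite act_perm_elt /= tpermK.
Qed.

(** The product [w] of all the [e y] is the empty map; an element [s] missing
    [y] is [e y * s], hence similar to [w * s = w]. *)
Lemma punctured_small_sim s t :
  small_image act s -> small_image act t -> sim s t.
Proof.
move=> ss st; pose w := (\prod_(z <- map e (enum Omega)) z)%g.
have wE x : act w x = None.
  suff prodE (l : seq Omega) :
      act (\prod_(z <- map e l) z)%g x = if x \in l then None else Some x.
    by rewrite prodE mem_enum.
  elim: l => [|y l IH]; first by rewrite big_nil act1.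
  rewrite big_cons actM IH inE; case: (x \in l); first by rewrite orbT.
  by rewrite orbF /= actE.
have w0 u : (w * u = w)%g.
  by apply/act_inj/funext => x; rewrite actM wE; case: (act u x).
suff sim_w u : small_image act u -> sim u w.
  by apply: sim_trans (sim_w s ss) (sim_sym (sim_w t st)).
move=> /small_imageP[y /puncture_mul_id yu].
apply: sim_left_zero yu w0 _; apply/sim_sym/sim_prod_idem.
- exact: puncture_idem.
- by rewrite -size_eq0 size_map -cardE -lt0n; apply/card_gt0P; exists y.
- by move=> _ /mapP[z _ ->]; exact: sim_puncture.
Qed.

Lemma puncture_small y : small_image act (e y).
Proof.
by apply/small_imageP; exists y => x; rewrite actE; case: eqP => // nxy [xy].
Qed.

End Punctured.

(** * Full transformations missing a point *)

Section Collapse.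
Variable Omega : finType.
Implicit Types (x y z : Omega) (s : transf Omega).

Definition collapse y z : transf Omega := fun x => if x == y then z else x.

Lemma act_transf_inj : injective (@act_transf Omega).
Proof. by move=> s t st; apply/funext => x; have [] := congr1 (@^~ x) st. Qed.

Lemma act_transf_perm (g : {perm Omega}) : exists s, act_transf s = Some \o g.
Proof. by exists g. Qed.

Lemma sim_collapse y z a b :
  y != z -> a != b -> sim (collapse y z) (collapse a b).
Proof.
move=> yz ab; have [g [<- <-]] := perm2_transitive yz ab.
pose u h : transf Omega := fun x => (h : {perm Omega}) x.
have uV : (u (g^-1)%g * u g = 1)%g by apply/funext => x; exact: permK.
apply: sim_sym.
suff <- : (u g * collapse y z * u (g^-1)%g = collapse (g y) (g z))%g.
  exact: sim_conj.
apply/funext => x; rewrite !transf_mulE /u /collapse (canF_eq (permKV g)).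
by case: ifP => // _; rewrite permKV.
Qed.

Lemma collapse_idem y z : (collapse y z * collapse y z = collapse y z)%g.
Proof.
apply/funext => x; rewrite transf_mulE /collapse.
by case: (x == y) / boolP => [_|/negbTE->//]; case: ifP.
Qed.

Definition const_transf z : transf Omega := fun=> z.

(** The product of the [collapse a z] over all [a != z] is constant. *)
Lemma sim_collapse_const y z : y != z -> sim (collapse y z) (const_transf z).
Proof.
move=> yz; apply: sim_sym.
have prodE (l : seq Omega) x :
    (\prod_(s <- map (collapse^~ z) l) s)%g x = if x \in l then z else x.
  elim: l => [|a l IH]; first by rewrite big_nil.
  rewrite big_cons transf_mulE IH inE /collapse.
  by case: (x \in l); rewrite ?orbT ?orbF //; case: ifP.
have -> : const_transf z =
    (\prod_(s <- map (collapse^~ z) (enum (predC1 z))) s)%g.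
  apply/funext => x; rewrite prodE mem_enum inE.
  by have [|] := eqVneq x z.
apply: sim_prod_idem; first exact: collapse_idem.
  rewrite -size_eq0 size_map -cardE -lt0n; apply/card_gt0P; exists y.
  by rewrite inE.
by move=> _ /mapP[a + ->]; rewrite mem_enum inE => az; exact: sim_collapse.
Qed.

(** An element [u] missing [y] is [collapse y z * u] for every [z]; the value
    [u y] is a choice of [z] different from [y].  So [u] is similar to a
    constant, and two constants [a], [b] are the products [a * b] and
    [b * a]. *)
Lemma transf_small_sim (s t : transf Omega) :
  small_image (@act_transf Omega) s -> small_image (@act_transf Omega) t ->
  sim s t.
Proof.
have constM z u : (const_transf z * u = const_transf z)%g by [].
have sim_const u : small_image (@act_transf Omega) u ->
    exists z, sim u (const_transf z).
  move=> /small_imageP[y uy].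
  have nuy x : u x <> y by move=> xy; apply: (uy x); rewrite -xy.
  exists (u y); apply: (@sim_left_zero _ (collapse y (u y))) => //.
    apply/funext => x; rewrite transf_mulE /collapse.
    by case: eqP => // /nuy.
  by apply: sim_collapse_const; apply/eqP => yu; apply: (nuy y).
move=> /sim_const[a sa] /sim_const[b tb].
apply: sim_trans sa (sim_trans _ (sim_sym tb)).
rewrite -(constM a (const_transf b)) -[X in sim _ X](constM b (const_transf a)).
exact: simMC.
Qed.

Lemma const_small z :
  (1 < #|Omega|)%N -> small_image (@act_transf Omega) (const_transf z).
Proof.
move=> /card_gt1P[x [y [_ _ xy]]]; apply/small_imageP.
have [xz|xz] := eqVneq x z; [exists y => a [] zy|exists x => a [] zx].
  by move: xy; rewrite xz -zy eqxx.
by move: xz; rewrite -zx eqxx.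
Qed.

End Collapse.

(** * The three monoids *)

Theorem proposition31 :
  (forall Omega : Type, infinite_set [set: Omega] ->
     [/\ sim_universal (transf Omega),
         sim_universal (ptransf Omega)
       & sim_universal (syminv Omega)])
  /\
  (forall Omega : finType,
     [/\ sim_classes (transf Omega) =
           parity_image_classes (@act_transf Omega) `\ set0,
         sim_classes (ptransf Omega) =
           parity_image_classes (@act_ptransf Omega) `\ set0
       & sim_classes (syminv Omega) =
           parity_image_classes (@act_syminv Omega) `\ set0]
     /\
     ((1 < #|Omega|)%N ->
       [/\ (sim_classes (transf Omega) #= `I_3)%card,
           (sim_classes (ptransf Omega) #= `I_3)%card
         & (sim_classes (syminv Omega) #= `I_3)%card])).
Proof.
split=> [Omega Oinf|Omega].
  split; [exact: sim_universal_transf | exact: sim_universal_ptransf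
    | exact: sim_universal_syminv].
have actM_T (s t : transf Omega) x :
  act_transf (s * t)%g x = obind (act_transf s) (act_transf t x) by [].
have act1_T x : act_transf (1%g : transf Omega) x = Some x by [].
have inj_P : injective (@act_ptransf Omega) by [].
have actM_P (s t : ptransf Omega) x :
  act_ptransf (s * t)%g x = obind (act_ptransf s) (act_ptransf t x) by [].
have act1_P x : act_ptransf (1%g : ptransf Omega) x = Some x by [].
have perm_P (g : {perm Omega}) : exists s, act_ptransf s = Some \o g.
  by exists (Some \o g).
pose e_P y : ptransf Omega := fun x => if x == y then None else Some x.
have eE_P y x : act_ptransf (e_P y) x = if x == y then None else Some x by [].
have inj_I : injective (@act_syminv Omega) by exact: syminv_inj.
have actM_I (s t : syminv Omega) x :
  act_syminv (s * t)%g x = obind (act_syminv s) (act_syminv t x) by [].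
have act1_I x : act_syminv (1%g : syminv Omega) x = Some x by [].
have perm_I (g : {perm Omega}) : exists s, act_syminv s = Some \o g.
  by exists (exist _ _ (partial_inj_total (@perm_inj _ g))).
have e_inj y : partial_inj (e_P y).
  by move=> a b c; rewrite /e_P; case: eqP => // _ [->]; case: eqP => // _ [->].
pose e_I y : syminv Omega := exist _ _ (e_inj y).
have eE_I y x : act_syminv (e_I y) x = if x == y then None else Some x by [].
have small_P := punctured_small_sim inj_P actM_P act1_P perm_P eE_P.
have small_I := punctured_small_sim inj_I actM_I act1_I perm_I eE_I.
have inj_T := @act_transf_inj Omega.
have perm_T := @act_transf_perm Omega.
have small_T := @transf_small_sim Omega.
split.
  split; [exact: (sim_classes_parity_image inj_T actM_T act1_T perm_T small_T)
    | exact: (sim_classes_parity_image inj_P actM_P act1_P perm_P small_P)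
    | exact: (sim_classes_parity_image inj_I actM_I act1_I perm_I small_I)].
move=> O1; have /card_gt0P[y _] := ltnW O1; split.
- apply: (card_sim_classes inj_T actM_T act1_T perm_T small_T O1).
  by exists (const_transf y); exact: const_small.
- apply: (card_sim_classes inj_P actM_P act1_P perm_P small_P O1).
  by exists (e_P y); exact: (puncture_small eE_P).
- apply: (card_sim_classes inj_I actM_I act1_I perm_I small_I O1).
  by exists (e_I y); exact: (puncture_small eE_I).
Qed.
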